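(* Let $T_5$ be the graph on $5$ vertices consisting of $3$ triangles sharing a common base (that is, two adjacent vertices, together with three further pairwise non-adjacent vertices, each of which is adjacent to both of the first two). Then $T_5$ is an SPN graph; that is, every real symmetric $5\times 5$ copositive matrix $A$ whose graph $G(A)$ is (isomorphic to) $T_5$ is an SPN matrix.
   Context: A real symmetric $n\times n$ matrix $A$ is copositive if $x^TAx\ge 0$ for every entrywise nonnegative vector $x\in\mathbb{R}^n$. A real symmetric matrix $A$ is an SPN matrix if $A=P+N$, where $P$ is a real symmetric positive semidefinite matrix and $N$ is a symmetric entrywise nonnegative matrix. For a real symmetric $n\times n$ matrix $A=(a_{ij})$, the graph $G(A)$ is the simple undirected graph with vertex set $\{1,\dots,n\}$ in which distinct vertices $i,j$ are adjacent if and only if $a_{ij}\neq 0$ (no condition is imposed on the diagonal entries). A simple graph $G$ is called an SPN graph (or simply SPN) if every copositive matrix $A$ whose graph $G(A)$ is (isomorphic to) $G$ is an SPN matrix. *)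

(* Defs.v *)
From mathcomp Require Import all_boot all_order all_algebra.
From mathcomp Require Import reals.

Set Implicit Arguments.
Unset Strict Implicit.
Unset Printing Implicit Defensive.

Import Order.TTheory GRing.Theory Num.Theory.
Local Open Scope ring_scope.

Definition symmetric_mx (R : realType) (n : nat) (A : 'M[R]_n) : Prop :=
  A^T = A.

Definition nonneg_mx (R : realType) (m n : nat) (A : 'M[R]_(m, n)) : Prop :=
  forall i j, 0 <= A i j.

Definition qform (R : realType) (n : nat) (A : 'M[R]_n) (x : 'cV[R]_n) : R :=
  (x^T *m A *m x) 0 0.

Definition copositive (R : realType) (n : nat) (A : 'M[R]_n) : Prop :=
  symmetric_mx A /\ forall x : 'cV[R]_n, nonneg_mx x -> 0 <= qform A x.

Definition psd (R : realType) (n : nat) (A : 'M[R]_n) : Prop :=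
  symmetric_mx A /\ forall x : 'cV[R]_n, 0 <= qform A x.

Definition SPN (R : realType) (n : nat) (A : 'M[R]_n) : Prop :=
  exists P N : 'M[R]_n,
    [/\ psd P, symmetric_mx N, nonneg_mx N & A = P + N].

Record sgraph := SGraph {
  vertex :> finType;
  adj : rel vertex;
  adj_sym : symmetric adj;
  adj_irr : irreflexive adj
}.

Definition graph_iso (G H : sgraph) : Prop :=
  exists2 f : G -> H, bijective f & forall x y, adj (f x) (f y) = adj x y.

Section MatrixGraph.
Variables (R : realType) (n : nat) (A : 'M[R]_n) (symA : symmetric_mx A).

Definition mx_adj : rel 'I_n := fun i j => (i != j) && (A i j != 0).

Lemma mx_adj_sym : symmetric mx_adj.
Proof. by move=> i j; rewrite /mx_adj eq_sym -{1}symA mxE. Qed.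

Lemma mx_adj_irr : irreflexive mx_adj.
Proof. by move=> i; rewrite /mx_adj eqxx. Qed.

Definition mx_graph : sgraph := SGraph mx_adj_sym mx_adj_irr.

End MatrixGraph.

(* The order n of A is not fixed in advance: the isomorphism forces n = #|G|. *)
Definition SPN_graph (R : realType) (G : sgraph) : Prop :=
  forall (n : nat) (A : 'M[R]_n) (symA : symmetric_mx A),
    copositive A -> graph_iso (mx_graph symA) G -> SPN A.

(* The common base is {0, 1}; the other three vertices are 2, 3, 4. *)
Definition T5_adj : rel 'I_5 :=
  fun i j => (i != j) && ((i < 2)%N || (j < 2)%N).

Lemma T5_adj_sym : symmetric T5_adj.
Proof. by move=> i j; rewrite /T5_adj eq_sym orbC. Qed.

Lemma T5_adj_irr : irreflexive T5_adj.
Proof. by move=> i; rewrite /T5_adj eqxx. Qed.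

Definition T5 : sgraph := SGraph T5_adj_sym T5_adj_irr.

(* Main.v *)
Require Import Defs.
From mathcomp Require Import all_boot all_order all_algebra.
From mathcomp Require Import reals.
From mathcomp Require Import classical_sets boolp topology normedtype.
From mathcomp Require Import realfun derive ring lra.

(* Let u, v be the base of T_5.  It suffices to find vectors, one per vertex,
   whose Gram matrix is entrywise at most A.  Scale the diagonal entries of the
   three other vertices to 1.  Minimising over their coordinates shows that
   copositivity means q(x, y) >= l1_+^2 + l2_+^2 + l3_+^2 on the quadrant, with
   q the quadratic form of the base and -l_i the linear form that joins the i-th
   vertex to the base.
   A form l_i with nonnegative coefficients is removed by a Schur complement,
   and one with nonpositive coefficients can be replaced by 0.  The others are
   positive either near the x-axis ("rightward") or near the y-axis
   ("leftward"); by symmetry l1 and l2 are rightward.  Lower the negative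
   coefficient of l1 in absolute value until either it vanishes, and l1 can be
   removed, or the difference of both sides acquires a zero p at which l1 is
   active (nonnegative).  At p the squares of the active forms can be completed
   and q is their sum plus k (p2 x - p1 y)^2.  Each active form gets its own
   unit coordinate vector.  Because l1 is active, the inactive forms are at most
   one on each side of p (unless all three are rightward, which is easier), and
   the vector of an inactive form f is obtained from f_+^2 <= sum z_j+^2 by the
   same tangency argument: such an f is coefficientwise at most sum T_j z_j with
   T_j >= 0 and |T| <= 1.  The signs T_j >= 0 make the vectors of the three
   vertices pairwise obtuse, as the zero entries of A require. *)

Set Implicit Arguments.
Unset Strict Implicit.
Unset Printing Implicit Defensive.

Import Order.TTheory GRing.Theory Num.Theory.
Import numFieldNormedType.Exports.
Local Open Scope classical_set_scope.
Local Open Scope ring_scope.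

(** * Positive parts, second-order contact in one variable, behaviour at infinity *)

Section Real.
Variable R : realType.
Implicit Types (a b c t x y : R) (l : R * R) (q : R * R * R).

(** If [d < 0], the expression equals [- c - 2] at [x = (c + 1) / - d], which is negative because
    [0 <= c]. *)
Lemma affine_ge0_slope (c d : R) :
  (forall x, 0 <= x -> 0 <= c + 2 * d * x) -> 0 <= d.
Proof.
move=> h; have c0 : 0 <= c by have := h 0 (lexx 0); lra.
rewrite leNgt; apply/negP => d0.
have r0 : 0 <= (c + 1) / - d by rewrite divr_ge0 ?oppr_ge0 ?(ltW d0) ?addr_ge0.
have := h _ r0.
have -> : 2 * d * ((c + 1) / - d) = - 2 * (c + 1) by field; rewrite lt_eqF.
by lra.
Qed.

Definition pospart_sq a := Num.max 0 a ^+ 2.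

Lemma pospart_sq_ge0 a : 0 <= pospart_sq a. Proof. exact: sqr_ge0. Qed.

Lemma pospart_sq_pos a : 0 <= a -> pospart_sq a = a ^+ 2.
Proof. by move=> h; rewrite /pospart_sq max_r. Qed.

Lemma pospart_sq_neg a : a <= 0 -> pospart_sq a = 0.
Proof. by move=> h; rewrite /pospart_sq max_l // expr0n. Qed.

Lemma pospart_sqM k a : 0 <= k -> pospart_sq (k * a) = k ^+ 2 * pospart_sq a.
Proof. by move=> h; rewrite /pospart_sq -exprMn maxr_pMr // mulr0. Qed.

Lemma le_pospart_sq a b : a <= b -> pospart_sq a <= pospart_sq b.
Proof.
move=> ab; have [a0|a0] := leP a 0; first by rewrite pospart_sq_neg ?pospart_sq_ge0.
have b0 := le_trans (ltW a0) ab.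
by rewrite !pospart_sq_pos ?(ltW a0) // ler_pXn2r // nnegrE ltW.
Qed.

Lemma pospart_sq_continuous : continuous pospart_sq.
Proof.
move=> x; apply: (@continuous_comp _ _ _ (fun a : R => Num.max 0 a) (fun a => a ^+ 2)).
  by apply: continuous_max; [exact: cvg_cst|exact: cvg_id].
exact: exprn_continuous.
Qed.

Definition lin l x y := l.1 * x + l.2 * y.
Definition quad q x y := q.1.1 * x ^+ 2 + 2 * q.1.2 * x * y + q.2 * y ^+ 2.

(* A form that vanishes at [t0] is declared active exactly when it is positive
   to the right of [t0]. *)
Definition act_at t0 l :=
  (0 < lin l t0 1) || ((lin l t0 1 == 0) && (0 <= l.1)).

Lemma act_atT t0 l : act_at t0 l -> 0 <= lin l t0 1.
Proof. by case/orP => [/ltW//|/andP[/eqP-> _]]. Qed.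

Lemma act_atF t0 l : ~~ act_at t0 l -> lin l t0 1 <= 0.
Proof. by rewrite negb_or -leNgt => /andP[]. Qed.

Lemma act_at_near t0 l : \forall t \near t0,
  (t0 <= t -> pospart_sq (lin l t 1) = (act_at t0 l)%:R * lin l t 1 ^+ 2) /\
  `|pospart_sq (lin l t 1) - (act_at t0 l)%:R * lin l t 1 ^+ 2| <=
    l.1 ^+ 2 * (t - t0) ^+ 2.
Proof.
have cl : (fun t => lin l t 1) @ t0 --> lin l t0 1.
  apply: continuousD; last exact: cvg_cst.
  by apply: continuousM; [exact: cvg_cst|exact: cvg_id].
rewrite /act_at; case: (ltrgtP (lin l t0 1) 0) => l0 /=.
- near=> t.
  have lt : lin l t 1 < 0.
    by near: t; apply: (cvgr_lt (lin l t0 1)).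
  rewrite pospart_sq_neg ?(ltW lt)// !mul0r subrr normr0; split => //.
  by rewrite mulr_ge0 // sqr_ge0.
- near=> t.
  have lt : 0 < lin l t 1.
    by near: t; apply: (cvgr_gt (lin l t0 1)).
  rewrite pospart_sq_pos ?(ltW lt)// !mul1r subrr normr0; split => //.
  by rewrite mulr_ge0 // sqr_ge0.
- near=> t.
  have -> : lin l t 1 = l.1 * (t - t0) by move: l0; rewrite /lin; lra.
  rewrite -exprMn; set u := l.1 * _.
  have pu : pospart_sq u <= u ^+ 2.
    have [/pospart_sq_pos->//|/ltW/pospart_sq_neg->] := leP 0 u.
    exact: sqr_ge0.
  split; last by rewrite ler_norml;
    case: (0 <= l.1) => /=; have := sqr_ge0 u; have := pospart_sq_ge0 u; lra.
  move=> t0t; have [l1|l1] /= := leP 0 l.1.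
    by rewrite mul1r pospart_sq_pos // mulr_ge0 // subr_ge0.
  rewrite mul0r pospart_sq_neg //.
  by rewrite mulr_le0_ge0 ?subr_ge0 // ltW.
Unshelve. all: by end_near. Qed.

(** Since 0 is a minimum, the slope of the quadratic at [t0] is nonnegative seen from the right and
    nonpositive seen from the left, where the error is of second order. Exactness on the right then
    gives [0 <= A], and the quadratic is [A * (t - t0) ^+ 2]. *)
Lemma double_root_at (F : R -> R) (A E C K t0 : R) :
  0 < t0 -> (forall t, 0 <= t -> 0 <= F t) ->
  F t0 = 0 ->
  (\forall t \near t0, (t0 <= t -> F t = A * t ^+ 2 + 2 * E * t + C) /\
    F t <= A * t ^+ 2 + 2 * E * t + C + K * (t - t0) ^+ 2) ->
  [/\ 0 <= A, E = - A * t0 & C = A * t0 ^+ 2].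
Proof.
move=> t0_gt0 F0 Ft0 /nbhs_ballP[d /= d0 near_t0].
have Q0 : A * t0 ^+ 2 + 2 * E * t0 + C = 0.
  by have [/(_ (lexx _)) <- _] := near_t0 t0 (ballxx _ d0).
have right_ge0 h : 0 < h -> h < d -> 0 <= A * h + 2 * (A * t0 + E).
  move=> h0 hd; have [|] := near_t0 (t0 + h).
    by rewrite /ball /= opprD addNKr normrN gtr0_norm.
  rewrite lerDl => /(_ (ltW h0)) FE _.
  have := F0 (t0 + h); rewrite FE addr_ge0 ?(ltW h0) ?(ltW t0_gt0)// => /(_ isT).
  have -> : A * (t0 + h) ^+ 2 + 2 * E * (t0 + h) + C =
    h * (A * h + 2 * (A * t0 + E)) by move: Q0; lra.
  by rewrite pmulr_rge0.
have left_le0 h : 0 < h -> h < d -> h <= t0 -> 2 * (A * t0 + E) <= (A + K) * h.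
  move=> h0 hd ht0; have [|_] := near_t0 (t0 - h).
    by rewrite /ball /= opprB addrC subrK gtr0_norm.
  have -> : A * (t0 - h) ^+ 2 + 2 * E * (t0 - h) + C + K * (t0 - h - t0) ^+ 2 =
    h * ((A + K) * h - 2 * (A * t0 + E)) by move: Q0; lra.
  move=> /(le_trans (F0 _ _)); rewrite subr_ge0 => /(_ ht0).
  by rewrite pmulr_rge0 // subr_ge0.
have vanish x y : (forall h, 0 < h -> h < d -> h <= t0 -> x <= y * h) -> x <= 0.
  move=> H; rewrite leNgt; apply/negP => x0.
  pose m := Num.min (d / 2) t0.
  have m0 : 0 < m by rewrite lt_min t0_gt0 divr_gt0.
  have md : m < d by rewrite gt_min ltr_pdivrMr // ltr_pMr // ltr1n.
  have mt : m <= t0 by rewrite ge_min lexx orbT.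
  have y0 : 0 < y by rewrite -(pmulr_lgt0 _ m0); apply: lt_le_trans x0 (H _ _ _ _).
  (* For this [h], [y * h] is at most [x / 2], against [x <= y * h]. *)
  pose h := Num.min m (x / (2 * y)).
  have h0 : 0 < h by rewrite lt_min m0 divr_gt0 // mulr_gt0.
  have hm : h <= m by rewrite ge_min lexx.
  have := H h h0 (le_lt_trans hm md) (le_trans hm mt).
  have : h <= x / (2 * y) by rewrite ge_min lexx orbT.
  rewrite ler_pdivlMr ?mulr_gt0 //; nra.
have e_le0 : A * t0 + E <= 0.
  by have := vanish _ _ left_le0; lra.
have e_ge0 : - (A * t0 + E) <= 0.
  apply: (vanish _ (A / 2)) => h h0 hd _.
  by have := right_ge0 h h0 hd; lra.
have EE : E = - A * t0 by lra.
split => //; last by move: Q0; rewrite EE; lra.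
have := right_ge0 (d / 2); rewrite EE divr_gt0 // ltr_pdivrMr // ltr_pMr // ltr1n.
by move=> /(_ isT isT); have : 0 < d / 2 by [rewrite divr_gt0]; nra.
Qed.

(** Activity at the far end of the slice [y = 1], that is in the direction [(1, 0)]: whether
    [lin l t 1] is nonnegative for all large [t]. *)
Definition act_infty l := (0 < l.1) || ((l.1 == 0) && (0 <= l.2)).

Lemma act_infty_near l : \forall t \near pinfty_nbhs R,
  pospart_sq (lin l t 1) = (act_infty l)%:R * lin l t 1 ^+ 2.
Proof.
rewrite /act_infty /lin; case: (ltrgtP l.1 0) => l0 /=.
- near=> t; rewrite mul0r pospart_sq_neg // mulr1.
  have : l.2 / - l.1 <= t by near: t; apply: nbhs_pinfty_ge; rewrite num_real.
  by rewrite ler_pdivrMr ?oppr_gt0 //; lra.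
- near=> t; rewrite mul1r pospart_sq_pos // mulr1.
  have : - l.2 / l.1 <= t by near: t; apply: nbhs_pinfty_ge; rewrite num_real.
  by rewrite ler_pdivrMr //; lra.
- near=> t; rewrite l0 mul0r add0r mulr1.
  case: leP => h /=; first by rewrite mul1r pospart_sq_pos.
  by rewrite mul0r pospart_sq_neg // ltW.
Unshelve. all: by end_near. Qed.

Lemma quad_infty_lt0 A E C : A < 0 \/ A = 0 /\ E < 0 ->
  \forall t \near pinfty_nbhs R, A * t ^+ 2 + 2 * E * t + C < 0.
Proof.
case=> [A0|[-> E0]]; near=> t.
  have t1 : 1 <= t by near: t; apply: nbhs_pinfty_ge; rewrite num_real.
  have : (2 * `|E| + `|C|) / - A < t.
    by near: t; apply: nbhs_pinfty_gt; rewrite num_real.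
  rewrite ltr_pdivrMr ?oppr_gt0 // => h.
  have := ler_norm E; have := ler_norm C; have := normr_ge0 C; nra.
have : C / - (2 * E) < t by near: t; apply: nbhs_pinfty_gt; rewrite num_real.
by rewrite ltr_pdivrMr; lra.
Unshelve. all: by end_near. Qed.

End Real.

(** * Lowering a coefficient until a second-order contact appears *)

Section Tangency.
Variable R : realType.
Variables (I : finType) (q : R * R * R) (e : I -> R) (l : I -> R * R).

(** The weights [e] serve two uses: -1 when squared positive parts are subtracted from [q], and 1,
    with [q = 0], when an inactive form is bounded. *)
Definition pwquad x y :=
  quad q x y + \sum_i e i * pospart_sq (lin (l i) x y).

Lemma linM (f : R * R) k x y : lin f (k * x) (k * y) = k * lin f x y.
Proof. by rewrite /lin; ring. Qed.

Lemma pwquadM k x y : 0 <= k -> pwquad (k * x) (k * y) = k ^+ 2 * pwquad x y.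
Proof.
move=> k0; rewrite /pwquad mulrDr mulr_sumr; congr (_ + _).
  by rewrite /quad; ring.
by apply: eq_bigr => i _; rewrite linM pospart_sqM // mulrCA.
Qed.

Lemma pwquad_continuous : continuous (fun t => pwquad t 1).
Proof.
move=> t; apply: cvgD.
  apply: cvgD; last exact: cvg_cst.
  apply: cvgD; first by apply: cvgM; [exact: cvg_cst|exact: exprn_continuous].
  apply: cvgM; last exact: cvg_cst.
  by apply: cvgM; [exact: cvg_cst|exact: cvg_id].
apply: cvg_big; first exact: add_continuous.
move=> i _; apply: cvgM; first exact: cvg_cst.
apply: (@continuous_comp _ _ _ (fun t => lin (l i) t 1) (@pospart_sq R)).
  by apply: cvgD; [apply: cvgM|]; do ?[exact: cvg_cst | exact: cvg_id].
exact: pospart_sq_continuous.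
Qed.

Section Active.
Variables (alpha beta : R) (s : I -> bool).

Definition pw_coef11 := q.1.1 + \sum_i e i * (s i)%:R * (l i).1 ^+ 2 - alpha ^+ 2.
Definition pw_coef12 :=
  q.1.2 + \sum_i e i * (s i)%:R * ((l i).1 * (l i).2) + alpha * beta.
Definition pw_coef22 := q.2 + \sum_i e i * (s i)%:R * (l i).2 ^+ 2 - beta ^+ 2.

Lemma pw_coefE x y :
  quad q x y + \sum_i e i * (s i)%:R * lin (l i) x y ^+ 2
    - lin (alpha, - beta) x y ^+ 2 =
  pw_coef11 * x ^+ 2 + 2 * pw_coef12 * x * y + pw_coef22 * y ^+ 2.
Proof.
have -> : \sum_i e i * (s i)%:R * lin (l i) x y ^+ 2 =
    (\sum_i e i * (s i)%:R * (l i).1 ^+ 2) * x ^+ 2 +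
    2 * (\sum_i e i * (s i)%:R * ((l i).1 * (l i).2)) * x * y +
    (\sum_i e i * (s i)%:R * (l i).2 ^+ 2) * y ^+ 2.
  rewrite mulr_sumr !mulr_suml -!big_split /=; apply: eq_bigr => i _.
  by rewrite /lin; ring.
by rewrite /quad /lin /pw_coef11 /pw_coef12 /pw_coef22 /=; ring.
Qed.

End Active.

Definition dominated alpha beta := forall x y, 0 <= x -> 0 <= y ->
  pospart_sq (lin (alpha, - beta) x y) <= pwquad x y.

(** By homogeneity only the ray [y = 0] and the slice [y = 1] matter. On the slice the condition is
    a lower bound on [beta] for each [t], so the least admissible [beta] is a supremum. *)
Lemma dominated_slice alpha beta : 0 <= alpha ->
  alpha ^+ 2 <= pwquad 1 0 -> (forall t, 0 <= t -> 0 <= pwquad t 1) ->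
  (forall t, 0 <= t -> alpha * t - Num.sqrt (pwquad t 1) <= beta) ->
  dominated alpha beta.
Proof.
move=> a0 d0 g0 h x y x0 y0; have [y_eq0|y_neq0] := eqVneq y 0.
  rewrite y_eq0 -(mulr1 x) -[X in lin _ _ X](mulr0 x) -[X in pwquad _ X](mulr0 x).
  rewrite pwquadM // linM pospart_sqM // ler_wpM2l ?sqr_ge0 //.
  by rewrite /lin /= mulr0 addr0 mulr1 pospart_sq_pos.
have t0 : 0 <= x / y by rewrite divr_ge0.
have yE : y = y * 1 by rewrite mulr1.
have -> : x = y * (x / y) by rewrite mulrCA divff ?mulr1.
rewrite [X in lin _ _ X]yE [X in pwquad _ X]yE.
rewrite pwquadM // linM pospart_sqM // ler_wpM2l ?sqr_ge0 //.
move: (h _ t0) (g0 _ t0); set t := x / y => ht gt.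
rewrite -[leRHS]sqr_sqrtr // -(pospart_sq_pos (sqrtr_ge0 _)).
by apply: le_pospart_sq; rewrite /lin /=; lra.
Qed.

(** The point of contact is [(p1, p2)]; the value [(1, 0)] stands for contact at the far end of the
    slice. *)
Definition touches alpha beta p1 p2 k (s : I -> bool) :=
  [/\ 0 <= p1, 0 <= p2, 0 < p1 + p2, 0 <= k & 0 <= lin (alpha, - beta) p1 p2] /\
  (forall i, if s i then 0 <= lin (l i) p1 p2 else lin (l i) p1 p2 <= 0) /\
  (forall x y, quad q x y + \sum_i e i * (s i)%:R * lin (l i) x y ^+ 2 =
    lin (alpha, - beta) x y ^+ 2 + k * (p2 * x - p1 * y) ^+ 2).

(** The difference of both sides is nonnegative on the slice and vanishes at [t0], so
    [double_root_at] applies to the quadratic that keeps the squares of the active forms and drops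
    the others. *)
Lemma touches_finite alpha beta t0 : 0 < alpha -> 0 < beta ->
  dominated alpha beta -> 0 <= t0 ->
  alpha * t0 - beta = Num.sqrt (pwquad t0 1) ->
  exists k s, touches alpha beta t0 1 k s.
Proof.
move=> a0 b0 dom t0_ge0 ht0.
have L0 : 0 <= lin (alpha, - beta) t0 1.
  by rewrite /lin /= mulr1 ht0 sqrtr_ge0.
have t0_gt0 : 0 < t0.
  rewrite lt_neqAle t0_ge0 andbT; apply/eqP => t00.
  by move: L0; rewrite /lin /= -t00; lra.
pose s i := act_at t0 (l i).
pose F t := pwquad t 1 - pospart_sq (lin (alpha, - beta) t 1).
have g0 t : 0 <= t -> 0 <= pwquad t 1.
  by move=> h; apply: le_trans (dom t 1 h ler01); exact: pospart_sq_ge0.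
have F0 t : 0 <= t -> 0 <= F t by move=> h; rewrite subr_ge0 dom.
have Ft0 : F t0 = 0.
  by rewrite /F pospart_sq_pos // /lin /= mulr1 ht0 sqr_sqrtr ?subrr ?g0.
have sL : act_at t0 (alpha, - beta).
  by move: L0; rewrite /act_at le_eqVlt eq_sym => /orP[->|->] //; rewrite (ltW a0) orbT.
(* The sum of the errors allowed by [act_at_near] over all forms, [(alpha, - beta)] included. *)
pose K := \sum_i `|e i| * (l i).1 ^+ 2 + alpha ^+ 2.
have := @double_root_at _ F (pw_coef11 alpha s) (pw_coef12 alpha beta s)
  (pw_coef22 beta s) K t0 t0_gt0 F0 Ft0.
case.
  near=> t.
  have near_i i : (t0 <= t -> pospart_sq (lin (l i) t 1) =
      (s i)%:R * lin (l i) t 1 ^+ 2) /\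
      `|pospart_sq (lin (l i) t 1) - (s i)%:R * lin (l i) t 1 ^+ 2| <=
      (l i).1 ^+ 2 * (t - t0) ^+ 2.
    by move: i; near: t; apply: filter_forall => i; exact: act_at_near.
  have [LE LK] : (t0 <= t -> pospart_sq (lin (alpha, - beta) t 1) =
      lin (alpha, - beta) t 1 ^+ 2) /\
      `|pospart_sq (lin (alpha, - beta) t 1) - lin (alpha, - beta) t 1 ^+ 2| <=
      alpha ^+ 2 * (t - t0) ^+ 2.
    near: t; have := act_at_near t0 (alpha, - beta); rewrite sL /=.
    by apply: filterS => t; rewrite mul1r.
  have := pw_coefE alpha beta s t 1; rewrite expr1n !mulr1 => <-.
  split=> [t0t|].
    rewrite /F /pwquad (LE t0t); congr (_ + _ - _).
    by apply: eq_bigr => i _; rewrite (proj1 (near_i i) t0t) mulrA.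
  rewrite /F /pwquad /K mulrDl.
  set S1 := \sum_i _; set S2 := \sum_i _; set S3 := \sum_i _.
  have : S1 - S2 <= S3 * (t - t0) ^+ 2.
    rewrite /S1 /S2 /S3 -sumrB mulr_suml; apply: ler_sum => i _.
    rewrite -mulrA -mulrBr; apply: le_trans (ler_norm _) _.
    by rewrite normrM -mulrA ler_wpM2l //; have [] := near_i i.
  by move: LK; rewrite ler_norml => /andP[]; lra.
move=> k0 E12 E22; exists (pw_coef11 alpha s), s; split; first by split => //; lra.
split=> [i|x y].
  by rewrite /s; case: ifPn => [/act_atT|/act_atF].
have := pw_coefE alpha beta s x y; rewrite E12 E22.
move: (quad q x y + _) => G /(canRL (subrK _)) ->; ring.
Unshelve. all: by end_near. Qed.

(** For large [t] the difference is a single quadratic [Q], nonnegative there, so neither [A < 0]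
    nor [A = 0] with [E < 0] is possible. Near-optimality of [beta] gives [Q t < 2 * eps * (alpha *
    t - beta) + eps ^+ 2] for arbitrarily large [t], which excludes positive [A] and [E]. Only the
    constant [C] survives, as the coefficient [k]. *)
Lemma touches_infinity alpha beta : 0 < alpha -> 0 < beta ->
  dominated alpha beta ->
  (forall T eps, 0 < eps -> exists2 t,
     T < t & beta - eps < alpha * t - Num.sqrt (pwquad t 1)) ->
  exists k s, touches alpha beta 1 0 k s.
Proof.
move=> a0 b0 dom adh.
pose s i := act_infty (l i).
pose A := pw_coef11 alpha s; pose E := pw_coef12 alpha beta s.
pose C := pw_coef22 beta s.
pose Q t := A * t ^+ 2 + 2 * E * t + C.
have g0 t : 0 <= t -> 0 <= pwquad t 1.
  by move=> h; apply: le_trans (dom t 1 h ler01); exact: pospart_sq_ge0.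
have gE : \forall t \near pinfty_nbhs R, [/\ 0 <= t, 0 <= Q t &
    pwquad t 1 = Q t + (alpha * t - beta) ^+ 2].
  near=> t.
  have t0 : 0 <= t by near: t; apply: nbhs_pinfty_ge; rewrite num_real.
  have near_i i : pospart_sq (lin (l i) t 1) = (s i)%:R * lin (l i) t 1 ^+ 2.
    by move: i; near: t; apply: filter_forall => i; exact: act_infty_near.
  have L0 : 0 <= lin (alpha, - beta) t 1.
    have : beta / alpha <= t by near: t; apply: nbhs_pinfty_ge; rewrite num_real.
    by rewrite ler_pdivrMr // /lin /=; lra.
  have gQ : pwquad t 1 = Q t + (alpha * t - beta) ^+ 2.
    have := pw_coefE alpha beta s t 1; rewrite expr1n !mulr1 -/A -/E -/C -/(Q t) => <-.
    rewrite /lin /= mulr1 subrK /pwquad; congr (_ + _).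
    by apply: eq_bigr => i _; rewrite near_i mulrA.
  split=> //; have := dom t 1 t0 ler01; rewrite pospart_sq_pos // gQ.
  by rewrite /lin /= mulr1 lerDr.
have Qnn : ~ (A < 0 \/ A = 0 /\ E < 0).
  move/(quad_infty_lt0 C) => lt0.
  have [t [[_ Q0 _] ]] := filter_ex (filterI gE lt0).
  by rewrite ltNge Q0.
have Qnp eps : 0 < eps -> ~ (- A < 0 \/ - A = 0 /\ - (E - alpha * eps) < 0).
  move=> eps0 /(quad_infty_lt0 (- (C + 2 * eps * beta - eps ^+ 2))) gt0.
  have [T [_ near_T]] := filterI gE gt0.
  have [t /near_T[[t0 Q0 gQ] lt0]] := adh T eps eps0.
  have := sqr_sqrtr (g0 _ t0); rewrite gQ /Q; move: lt0.
  have := sqrtr_ge0 (Q t + (alpha * t - beta) ^+ 2); move: (Num.sqrt _) => r.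
  nra.
have A0 : A = 0.
  have := Qnp 1 ltr01; have : ~ (A < 0) by move=> h; apply: Qnn; left.
  move=> /negP; rewrite -leNgt le_eqVlt => /orP[/eqP->//|Apos] [].
  by left; rewrite oppr_lt0.
have E0 : E = 0.
  have : ~ (E < 0) by move=> h; apply: Qnn; right.
  move=> /negP; rewrite -leNgt le_eqVlt => /orP[/eqP->//|Epos].
  (* This [eps] leaves [E - alpha * eps = E / 2], still positive. *)
  case: (Qnp (E / (2 * alpha))); first by rewrite divr_gt0 // mulr_gt0.
  right; rewrite A0 oppr0; split=> //.
  have -> : alpha * (E / (2 * alpha)) = E / 2 by field; rewrite gt_eqF.
  by lra.
have C0 : 0 <= C.
  by have [t [_ + _]] := filter_ex gE; rewrite /Q A0 E0 mulr0 !mul0r !add0r.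
exists C, s; split; first by split=> //; rewrite /lin /=; lra.
split=> [i|x y].
  rewrite /s /act_infty /lin mulr1 mulr0 addr0.
  by case: (ltrgtP (l i).1 0) => //= _; case: ifP.
have := pw_coefE alpha beta s x y; rewrite -/A -/E -/C A0 E0.
move: (quad q x y + _) => G /(canRL (subrK _)) ->; ring.
Unshelve. all: by end_near. Qed.

(** Take for [b] the supremum of [h], the least admissible value. If it is at most 0, then 0 is
    admissible; if it is attained, the contact is at a finite point; otherwise it is at infinity. *)
Lemma tangency alpha beta : 0 <= alpha -> 0 <= beta -> dominated alpha beta ->
  dominated alpha 0 \/
  exists b p1 p2 k s, [/\ 0 <= b, b <= beta, dominated alpha b &
    touches alpha b p1 p2 k s].
Proof.
rewrite le_eqVlt => /predU1P[<-|a0] b0 dom.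
  left=> x y x0 y0; apply: le_trans (dom _ _ x0 y0).
  by rewrite pospart_sq_neg ?pospart_sq_ge0 // /lin /= !mul0r oppr0 mul0r addr0.
have g0 t : 0 <= t -> 0 <= pwquad t 1.
  by move=> h; apply: le_trans (dom t 1 h ler01); exact: pospart_sq_ge0.
have ga : alpha ^+ 2 <= pwquad 1 0.
  have := dom 1 0 ler01 (lexx 0).
  by rewrite /lin /= mulr0 addr0 mulr1 pospart_sq_pos // ltW.
pose h t := alpha * t - Num.sqrt (pwquad t 1).
have h_le t : 0 <= t -> h t <= beta.
  move=> t0; rewrite /h lerBlDr -lerBlDl.
  have [/le_trans->//|pos] := leP (alpha * t - beta) 0; first exact: sqrtr_ge0.
  rewrite -(ger0_norm (ltW pos)) -sqrtr_sqr ler_wsqrtr //.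
  have := dom t 1 t0 ler01; rewrite /lin /= mulr1 pospart_sq_pos //; exact: ltW.
pose H := h @` [set t | 0 <= t].
have supH : has_sup H.
  split; first by exists (h 0), 0 => /=.
  by exists beta => _ [t /h_le ? <-].
have h_sup t : 0 <= t -> h t <= sup H.
  by move=> t0; apply: sup_upper_bound => //; exists t.
have [sup0|sup0] := leP (sup H) 0.
  left; apply: dominated_slice (ltW a0) ga g0 _ => t /h_sup; rewrite /h => h1.
  by apply: le_trans sup0.
have doms : dominated alpha (sup H) by exact: dominated_slice (ltW a0) ga g0 h_sup.
have supb : sup H <= beta.
  apply: ge_sup; first by case: supH.
  by move=> _ [t /h_le ? <-].
right; exists (sup H).
have [[t0 t0_ge0 ht0]|natt] := pselect (exists2 t, 0 <= t & h t = sup H).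
  have [|k [s tch]] := touches_finite a0 sup0 doms t0_ge0.
    by rewrite -ht0 /h opprB addrCA subrr addr0.
  by exists t0, 1, k, s; split=> //; exact: ltW.
have h_lt t : 0 <= t -> h t < sup H.
  by move=> t0; rewrite lt_neqAle h_sup // andbT; apply/eqP => ?; apply: natt; exists t.
have [|k [s tch]] := touches_infinity a0 sup0 doms.
  move=> T eps eps0; pose T' := Num.max 0 T.
  have T'0 : 0 <= T' by rewrite le_max lexx.
  have hc : {within `[0, T'], continuous h}.
    apply: continuous_subspaceT => t; apply: cvgB.
      by apply: cvgM; [exact: cvg_cst|exact: cvg_id].
    apply: (@continuous_comp _ _ _ (fun t => pwquad t 1) (@Num.sqrt R)).
      exact: pwquad_continuous.
    exact: sqrt_continuous.
  (* The maximum of [h] on the interval stays below the supremum, so values closer to the supremum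
     than this gap occur only beyond [T]. *)
  have [c + hmax] := EVT_max T'0 hc.
  rewrite in_itv /= => /andP[c0 _].
  pose d := Num.min eps (sup H - h c).
  have d0 : 0 < d by rewrite lt_min eps0 subr_gt0 h_lt.
  have [_ [t /= t0 <-] ht] := sup_adherent d0 supH.
  have dh : d <= sup H - h c by rewrite ge_min lexx orbT.
  have de : d <= eps by rewrite ge_min lexx.
  exists t; last by apply: le_lt_trans ht; lra.
  rewrite ltNge; apply/negP => tT.
  have := hmax t; rewrite in_itv /= t0 le_max tT orbT => /(_ isT); lra.
by exists 1, 0, k, s; split=> //; exact: ltW.
Qed.

End Tangency.

(** * Bounding an inactive form by a nonnegative combination of other forms *)

Section Support.
Variable R : realType.
Implicit Types (l f g h : R * R) (q : R * R * R).

(** With [c = lam / |m|^2] the vector [c m] has length [lam / |m|], at most 1. For [m = 0] division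
    by zero gives [c = 0], and the hypothesis forces [lam = 0]. *)
Lemma unit_multiple (I : finType) (m : I -> R) (lam : R) :
  0 <= lam -> lam ^+ 2 <= \sum_i m i ^+ 2 ->
  exists c, [/\ 0 <= c, \sum_i (c * m i) ^+ 2 <= 1 &
    \sum_i c * m i * m i = lam].
Proof.
move=> lam0 lamM; set M := \sum_i _ in lamM.
have M0 : 0 <= M by apply: le_trans lamM; exact: sqr_ge0.
exists (lam / M); split; first by rewrite divr_ge0.
  under eq_bigr do rewrite exprMn.
  rewrite -mulr_sumr -/M; have [->|Mn0] := eqVneq M 0.
    by rewrite mulr0 ler01.
  have -> : (lam / M) ^+ 2 * M = lam ^+ 2 / M by field.
  by rewrite ler_pdivrMr ?lt0r ?Mn0 // mul1r.
under eq_bigr do rewrite -mulrA -expr2.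
rewrite -mulr_sumr -/M; have [M00|Mn0] := eqVneq M 0; last by rewrite mulfVK.
apply/eqP; rewrite M00 mulr0 eq_sym -sqrf_eq0 eq_le sqr_ge0 andbT.
by rewrite -M00.
Qed.

Definition rightward l := 0 <= l.1 /\ l.2 <= 0.
Definition leftward l := l.1 <= 0 /\ 0 <= l.2.

Definition quad0 : R * R * R := (0, 0, 0).

(** Tangency with [q = 0] ends in an identity of quadratic forms at a contact point. Polarised
    there, it writes the lowered form as a combination of the active [z i], weighted by their
    nonnegative values. A vanishing second coefficient and a form vanishing at the contact point are
    treated apart. *)
Lemma support (I : finType) (z : I -> R * R) (alpha beta : R) :
  (forall i, rightward (z i)) -> 0 <= alpha -> 0 <= beta ->
  dominated quad0 (fun=> 1) z alpha beta ->
  exists T : I -> R, [/\ forall i, 0 <= T i, \sum_i T i ^+ 2 <= 1,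
    alpha <= \sum_i T i * (z i).1 & - beta <= \sum_i T i * (z i).2].
Proof.
move=> zR a0 b0 /(tangency a0 b0) [dom|[b [p1 [p2 [k [s [b_ge0 bb _ tch]]]]]]].
  pose m i := if (z i).2 == 0 then (z i).1 else 0.
  have [|c [c0 cm1 cma]] := @unit_multiple I m alpha a0.
    (* Large enough that each [z i] with negative second coefficient is nonpositive at [(1, y)];
       only those with second coefficient 0 then contribute. *)
    pose y := \sum_i `|(z i).1 / (z i).2|.
    have y0 : 0 <= y by apply: sumr_ge0.
    have := dom 1 y ler01 y0; rewrite pospart_sq_pos; last first.
      by rewrite /lin /= mulr1 oppr0 mul0r addr0.
    rewrite {1}/lin /= mulr1 oppr0 mul0r addr0 => /le_trans; apply.
    rewrite /pwquad /quad /= !mul0r !mulr0 !mul0r !add0r; apply: ler_sum => i _.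
    rewrite mul1r /m /lin mulr1; have [z1 z2] := zR i.
    case: eqVneq => [->|zn0]; first by rewrite mul0r addr0 pospart_sq_pos.
    rewrite pospart_sq_neg ?sqr_ge0 //.
    have : `|(z i).1 / (z i).2| <= y.
      by rewrite /y (bigD1 i) //= lerDl sumr_ge0.
    have zlt : (z i).2 < 0 by rewrite lt_neqAle zn0.
    rewrite normrM normfV (ger0_norm z1) (ltr0_norm zlt) ler_pdivrMr ?oppr_gt0 //.
    by lra.
  exists (fun i => c * m i); split=> //.
  - by move=> i; rewrite mulr_ge0 // /m; case: ifP => // _; have [] := zR i.
  - rewrite -cma; apply: ler_sum => i _; rewrite /m; case: ifP => // _.
    by rewrite !mulr0 mul0r.
  - rewrite big1 ?oppr_le0 // => i _; rewrite /m; case: eqP => [->|_].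
      by rewrite mulr0.
    by rewrite mulr0 mul0r.
case: tch => -[p1_ge0 p2_ge0 p_gt0 k0 Lp] [sgn id0].
have id x y : \sum_i (s i)%:R * lin (z i) x y ^+ 2 =
    lin (alpha, - b) x y ^+ 2 + k * (p2 * x - p1 * y) ^+ 2.
  rewrite -id0 /quad /= !mul0r mulr0 !mul0r !add0r.
  by apply: eq_bigr => i _; rewrite mul1r.
(* The term in [k] drops out because [p2 * x - p1 * y] vanishes at [(p1, p2)]. *)
have {id0} polar x y : \sum_i (s i)%:R * lin (z i) p1 p2 * lin (z i) x y =
    lin (alpha, - b) p1 p2 * lin (alpha, - b) x y.
  have := id (x + p1) (y + p2); have := id x y; have := id p1 p2.
  set S1 := \sum_i _; set S2 := \sum_i _; set S3 := \sum_i _; set S := \sum_i _.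
  have -> : S3 = S2 + S1 + 2 * S.
    rewrite /S1 /S2 /S3 /S mulr_sumr -!big_split /=; apply: eq_bigr => i _.
    by rewrite /lin; ring.
  by rewrite /lin /=; lra.
have sz0 i : 0 <= (s i)%:R * lin (z i) p1 p2.
  by have := sgn i; case: (s i) => h; rewrite ?mul1r ?mul0r.
(* If the lowered form vanishes at the contact point, so do the active [z i]. All are then multiples
   of [(p2, - p1)], with factors [lam] and [mu i], and [unit_multiple] combines them. *)
move: Lp; rewrite le_eqVlt eq_sym => /predU1P[Lp0|Lp].
  have szE i : (s i)%:R * lin (z i) p1 p2 = 0.
    have := polar p1 p2; rewrite Lp0 mul0r => /eqP.
    rewrite psumr_eq0; last first.
      move=> j _; have := sgn j; case: (s j) => h; rewrite ?mul1r ?mul0r ?mul0r //.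
      by rewrite -expr2 sqr_ge0.
    move=> /allP/(_ i (mem_index_enum _)) /= /eqP.
    case: (s i); rewrite ?mul0r // mul1r => /eqP.
    by rewrite mulf_eq0 orbb => /eqP.
  pose n := p1 ^+ 2 + p2 ^+ 2.
  have n0 : 0 < n by have := exprn_gt0 2 p_gt0; have := sqr_ge0 (p1 - p2); rewrite /n; nra.
  pose mu i := (s i)%:R * lin (z i) p2 (- p1) / n.
  pose lam := lin (alpha, - b) p2 (- p1) / n.
  have lam0 : 0 <= lam by rewrite divr_ge0 ?(ltW n0) // /lin /=; nra.
  have mu0 i : 0 <= mu i.
    rewrite divr_ge0 ?(ltW n0) // mulr_ge0 // /lin; have [] := zR i; nra.
  have [|c [c0 cm1 cml]] := @unit_multiple I mu lam lam0.
    have := id p2 (- p1); have -> : p2 * p2 - p1 * - p1 = n by rewrite /n; ring.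
    move=> E; have -> : \sum_i mu i ^+ 2 =
        (\sum_i (s i)%:R * lin (z i) p2 (- p1) ^+ 2) / n ^+ 2.
      rewrite mulr_suml; apply: eq_bigr => i _; rewrite /mu !exprMn exprVn.
      by congr (_ * _ / _); case: (s i); rewrite expr2 ?mul1r ?mul0r.
    rewrite E /lam exprMn exprVn ler_wpM2r ?invr_ge0 ?exprn_ge0 ?(ltW n0) //.
    by rewrite lerDl mulr_ge0 // sqr_ge0.
  have vanish f : lin f p1 p2 = 0 ->
      f.1 = lin f p2 (- p1) / n * p2 /\ f.2 = - (lin f p2 (- p1) / n * p1).
    rewrite /lin => f0; split; apply: (mulIf (lt0r_neq0 n0)).
      rewrite mulrAC mulfVK ?gt_eqF // /n.
      have -> : f.1 * (p1 ^+ 2 + p2 ^+ 2) = (f.1 * p1 + f.2 * p2) * p1 +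
          (f.1 * p2 - f.2 * p1) * p2 by ring.
      by rewrite f0; ring.
    rewrite mulNr mulrAC mulfVK ?gt_eqF // /n.
    have -> : f.2 * (p1 ^+ 2 + p2 ^+ 2) = (f.1 * p1 + f.2 * p2) * p2 -
        (f.1 * p2 - f.2 * p1) * p1 by ring.
    by rewrite f0; ring.
  have muE i : c * mu i * (z i).1 = c * mu i * mu i * p2 /\
      c * mu i * (z i).2 = - (c * mu i * mu i * p1).
    have := szE i; rewrite /mu; case: (s i); last by rewrite !mul0r !mulr0 !mul0r oppr0.
    by rewrite !mul1r => /vanish[-> ->]; split; ring.
  have [aE bE] := vanish _ Lp0.
  exists (fun i => c * mu i); split=> // [i||].
  - by rewrite mulr_ge0.
  - under eq_bigr do rewrite (proj1 (muE _)).
    by rewrite -mulr_suml cml -[leRHS]aE.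
  - under eq_bigr do rewrite (proj2 (muE _)).
    by rewrite sumrN -mulr_suml cml -[leRHS]bE lerN2.
set r := lin _ p1 p2 in Lp polar.
(* [polar] at [(p1, p2)] shows that these weights have norm 1; at [(1, 0)] and [(0, 1)] it gives the
   two coefficients. *)
exists (fun i => (s i)%:R * lin (z i) p1 p2 / r); split.
- by move=> i; rewrite divr_ge0 // ltW.
- have -> : \sum_i ((s i)%:R * lin (z i) p1 p2 / r) ^+ 2 =
      (\sum_i (s i)%:R * lin (z i) p1 p2 * lin (z i) p1 p2) / r ^+ 2.
    rewrite mulr_suml; apply: eq_bigr => i _; rewrite !exprMn exprVn.
    by congr (_ / _); case: (s i); rewrite expr2 ?mul1r ?mul0r ?mul0r // expr2.
  by rewrite polar -expr2 divff // expf_neq0 // gt_eqF.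
- have -> : \sum_i (s i)%:R * lin (z i) p1 p2 / r * (z i).1 =
      (\sum_i (s i)%:R * lin (z i) p1 p2 * lin (z i) 1 0) / r.
    rewrite mulr_suml; apply: eq_bigr => i _.
    by rewrite [lin (z i) 1 0]/lin mulr1 mulr0 addr0 mulrAC.
  by rewrite polar mulrAC divff ?gt_eqF // mul1r /lin /= mulr1 mulr0 addr0.
- have -> : \sum_i (s i)%:R * lin (z i) p1 p2 / r * (z i).2 =
      (\sum_i (s i)%:R * lin (z i) p1 p2 * lin (z i) 0 1) / r.
    rewrite mulr_suml; apply: eq_bigr => i _.
    by rewrite [lin (z i) 0 1]/lin mulr1 mulr0 add0r mulrAC.
  by rewrite polar mulrAC divff ?gt_eqF // mul1r /lin /= mulr1 mulr0 add0r lerN2.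
Qed.

Lemma pospart_sq_split (a : R) : a ^+ 2 = pospart_sq a + pospart_sq (- a).
Proof.
have [a0|/ltW a0] := leP 0 a.
  by rewrite pospart_sq_pos // pospart_sq_neg ?oppr_le0 // addr0.
by rewrite pospart_sq_neg // pospart_sq_pos ?oppr_ge0 // sqrrN add0r.
Qed.

(** In this region [p2 * lin l x y] is at most [y * lin l p1 p2]; for [p2 = 0], nonpositivity at the
    point forces [l.1 = 0]. *)
Lemma rightward_le0 l p1 p2 x y : rightward l -> 0 <= p1 -> 0 <= p2 -> 0 < p1 + p2 ->
  lin l p1 p2 <= 0 -> 0 <= y -> p2 * x <= p1 * y -> lin l x y <= 0.
Proof.
rewrite /lin => -[l1 l2] p1_ge0; rewrite le_eqVlt => /predU1P[<-|p2_gt0] pgt lp y0 xy.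
  have -> : l.1 = 0 by nra.
  by nra.
rewrite -(pmulr_rle0 _ p2_gt0); nra.
Qed.

Lemma rightward_ge0 l p1 p2 x y : rightward l -> 0 <= p1 -> 0 <= p2 -> 0 < p1 + p2 ->
  0 <= lin l p1 p2 -> 0 <= x -> 0 <= y -> p1 * y <= p2 * x -> 0 <= lin l x y.
Proof.
rewrite /lin => -[l1 l2] p1_ge0; rewrite le_eqVlt => /predU1P[<-|p2_gt0] pgt lp x0 y0 xy.
  have -> : y = 0 by nra.
  by rewrite mulr0 addr0 mulr_ge0.
rewrite -(pmulr_rge0 _ p2_gt0); nra.
Qed.

Lemma linN l x y : lin (- l.1, - l.2) x y = - lin l x y.
Proof. by rewrite /lin /= !mulNr opprD. Qed.

(** [support] is applied to the residual form [sqrt k * (p2 x - p1 y)] and to [- g1], [- g2]. On the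
    y-axis side of the contact point [f] is nonpositive. On the other side [h] is nonnegative, so
    its terms cancel, and a square minus the squared positive part of [g] is that of [- g]. *)
Lemma inactive_support (k p1 p2 : R) f g1 g2 h :
  rightward f -> rightward h -> leftward g1 -> leftward g2 ->
  [/\ 0 <= p1, 0 <= p2, 0 < p1 + p2 & 0 <= k] ->
  lin f p1 p2 <= 0 -> 0 <= lin h p1 p2 ->
  (forall x y, 0 <= x -> 0 <= y ->
    pospart_sq (lin f x y) + pospart_sq (lin g1 x y) + pospart_sq (lin g2 x y) +
    pospart_sq (lin h x y) <=
    lin g1 x y ^+ 2 + lin g2 x y ^+ 2 + lin h x y ^+ 2 +
    k * (p2 * x - p1 * y) ^+ 2) ->
  exists T0 T1 T2, [/\ 0 <= T0, 0 <= T1, 0 <= T2, T0 ^+ 2 + T1 ^+ 2 + T2 ^+ 2 <= 1 &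
    f.1 <= T0 * (Num.sqrt k * p2) - T1 * g1.1 - T2 * g2.1 /\
    f.2 <= - T0 * (Num.sqrt k * p1) - T1 * g1.2 - T2 * g2.2].
Proof.
move=> fR hR [g11 g12] [g21 g22] [p1_ge0 p2_ge0 p_gt0 k0] fp hp feas.
pose z (i : 'I_3) : R * R := nth (0, 0) [:: (Num.sqrt k * p2, - (Num.sqrt k * p1));
  (- g1.1, - g1.2); (- g2.1, - g2.2)] i.
have [f1 f2] := fR.
have sk0 : 0 <= Num.sqrt k := sqrtr_ge0 k.
have [||||T] := @support _ z f.1 (- f.2).
- by case=> [[|[|[|//]]] ?]; rewrite /rightward /z /=; split;
    rewrite ?oppr_ge0 ?oppr_le0 ?mulr_ge0.
- by [].
- by rewrite oppr_ge0.
- move=> x y x0 y0; rewrite opprK -surjective_pairing.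
  rewrite /pwquad /quad /= !mul0r mulr0 !mul0r !add0r !big_ord_recl big_ord0 addr0 /z /=.
  rewrite !mul1r !linN.
  have -> : lin (Num.sqrt k * p2, - (Num.sqrt k * p1)) x y =
    Num.sqrt k * (p2 * x - p1 * y) by rewrite /lin /=; ring.
  rewrite pospart_sqM // sqr_sqrtr //.
  have [xy|/ltW xy] := leP (p2 * x) (p1 * y).
    rewrite (pospart_sq_neg (rightward_le0 fR p1_ge0 p2_ge0 p_gt0 fp y0 xy)).
    by do ?[exact: pospart_sq_ge0 | exact: k0 | apply: addr_ge0 | apply: mulr_ge0].
  have := feas x y x0 y0.
  rewrite (pospart_sq_pos (rightward_ge0 hR p1_ge0 p2_ge0 p_gt0 hp x0 y0 xy)).
  rewrite [pospart_sq (p2 * x - _)]pospart_sq_pos ?subr_ge0 //.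
  rewrite (pospart_sq_split (lin g1 x y)) (pospart_sq_split (lin g2 x y)); lra.
rewrite !big_ord_recl !big_ord0 /z /= !addr0 opprK => -[T0 T1 fle1 fle2].
by exists (T ord0), (T (lift ord0 ord0)), (T (lift ord0 (lift ord0 ord0)));
  split=> //; [lra | split; lra].
Qed.

End Support.

(** * Realization of the forms by Gram vectors *)

Section Realizable.
Variable R : realType.
Implicit Types (l : R * R) (q : R * R * R).

Definition dot n (u v : 'rV[R]_n) := \sum_i u 0 i * v 0 i.

Lemma dotC n (u v : 'rV[R]_n) : dot u v = dot v u.
Proof. by apply: eq_bigr => i _; rewrite mulrC. Qed.

Lemma dot0v n (u : 'rV[R]_n) : dot 0 u = 0.
Proof. by rewrite /dot big1 // => i _; rewrite mxE mul0r. Qed.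

Lemma dotZl n (c : R) (u v : 'rV[R]_n) : dot (c *: u) v = c * dot u v.
Proof. by rewrite /dot mulr_sumr; apply: eq_bigr => i _; rewrite mxE mulrA. Qed.

Lemma dotZr n (c : R) (u v : 'rV[R]_n) : dot u (c *: v) = c * dot u v.
Proof. by rewrite dotC dotZl dotC. Qed.

Lemma dot_row_mx m n (a c : 'rV[R]_m) (b d : 'rV[R]_n) :
  dot (row_mx a b) (row_mx c d) = dot a c + dot b d.
Proof.
rewrite /dot big_split_ord /=; congr (_ + _); apply: eq_bigr => i _.
  by rewrite !row_mxEl.
by rewrite !row_mxEr.
Qed.

Lemma dot_const1 (a b : R) : dot (const_mx a : 'rV_1) (const_mx b) = a * b.
Proof. by rewrite /dot big_ord1 !mxE. Qed.

Definition row4 (a b c d : R) : 'rV[R]_4 := \row_i nth 0 [:: a; b; c; d] i.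

Lemma dot_row4 a b c d a' b' c' d' :
  dot (row4 a b c d) (row4 a' b' c' d') = a * a' + b * b' + c * c' + d * d'.
Proof. by rewrite /dot !big_ord_recl big_ord0 !mxE /= addr0 !addrA. Qed.

Definition feasible q l1 l2 l3 := forall x y, 0 <= x -> 0 <= y ->
  pospart_sq (lin l1 x y) + pospart_sq (lin l2 x y) + pospart_sq (lin l3 x y) <=
  quad q x y.

(** [w] is the opposite of a rescaled vertex vector, so lower bounds on its products with [u] and
    [v] become upper bounds on Gram entries. *)
Definition covers n (u v : 'rV[R]_n) l w :=
  [/\ l.1 <= dot w u, l.2 <= dot w v & dot w w <= 1].

Definition realizable q l1 l2 l3 :=
  exists n (u v w1 w2 w3 : 'rV[R]_n),
    [/\ dot u u <= q.1.1, dot u v <= q.1.2 & dot v v <= q.2] /\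
    [/\ covers u v l1 w1, covers u v l2 w2 & covers u v l3 w3] /\
    [/\ dot w1 w2 <= 0, dot w1 w3 <= 0 & dot w2 w3 <= 0].

Lemma feasible_swap12 q l1 l2 l3 : feasible q l1 l2 l3 -> feasible q l2 l1 l3.
Proof. by move=> h x y x0 y0; rewrite [X in X + _]addrC; exact: h. Qed.

Lemma feasible_swap23 q l1 l2 l3 : feasible q l1 l2 l3 -> feasible q l1 l3 l2.
Proof. by move=> h x y x0 y0; rewrite addrAC; exact: h. Qed.

Lemma realizable_swap12 q l1 l2 l3 : realizable q l1 l2 l3 -> realizable q l2 l1 l3.
Proof.
case=> n [u [v [w1 [w2 [w3 [hq [[c1 c2 c3] [d12 d13 d23]]]]]]]].
by exists n, u, v, w2, w1, w3; do !split=> //; rewrite dotC.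
Qed.

Lemma realizable_swap23 q l1 l2 l3 : realizable q l1 l2 l3 -> realizable q l1 l3 l2.
Proof.
case=> n [u [v [w1 [w2 [w3 [hq [[c1 c2 c3] [d12 d13 d23]]]]]]]].
by exists n, u, v, w1, w3, w2; do !split=> //; rewrite dotC.
Qed.

(** The exchange of the two base vertices, which also exchanges rightward and leftward forms. *)
Definition flip l := (l.2, l.1).
Definition qflip q := (q.2, q.1.2, q.1.1).

Lemma lin_flip l x y : lin (flip l) x y = lin l y x.
Proof. by rewrite /lin addrC. Qed.

Lemma quad_flip q x y : quad (qflip q) x y = quad q y x.
Proof. by rewrite /quad /=; ring. Qed.

Lemma feasible_flip q l1 l2 l3 :
  feasible q l1 l2 l3 -> feasible (qflip q) (flip l1) (flip l2) (flip l3).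
Proof. by move=> h x y x0 y0; rewrite !lin_flip quad_flip; exact: h. Qed.

Lemma realizable_flip q l1 l2 l3 :
  realizable (qflip q) (flip l1) (flip l2) (flip l3) -> realizable q l1 l2 l3.
Proof.
case=> n [u [v [w1 [w2 [w3 [[q1 q2 q3] [[[? ? ?] [? ? ?] [? ? ?]] hw]]]]]]].
by exists n, v, u, w1, w2, w3; do !split=> //; rewrite dotC.
Qed.

Lemma realizable_le q l1 l1' l2 l3 : l1.1 <= l1'.1 -> l1.2 <= l1'.2 ->
  realizable q l1' l2 l3 -> realizable q l1 l2 l3.
Proof.
move=> h1 h2 [n [u [v [w1 [w2 [w3 [hq [[[a1 a2 a3] c2 c3] hw]]]]]]]].
exists n, u, v, w1, w2, w3; do !split=> //.
  exact: le_trans a1.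
exact: le_trans a2.
Qed.

Definition qpeel q l := (q.1.1 - l.1 ^+ 2, q.1.2 - l.1 * l.2, q.2 - l.2 ^+ 2).

Lemma quad_peel q l x y : quad (qpeel q l) x y = quad q x y - lin l x y ^+ 2.
Proof. by rewrite /quad /lin /=; ring. Qed.

Lemma feasible_peel q l1 l2 l3 : 0 <= l1.1 -> 0 <= l1.2 ->
  feasible q l1 l2 l3 -> feasible (qpeel q l1) (0, 0) l2 l3.
Proof.
move=> h1 h2 h x y x0 y0; have := h x y x0 y0; rewrite quad_peel.
rewrite [pospart_sq (lin l1 _ _)]pospart_sq_pos; last first.
  by rewrite addr_ge0 ?mulr_ge0.
have -> : lin (0, 0) x y = 0 by rewrite /lin !mul0r addr0.
by rewrite [pospart_sq 0]pospart_sq_neg //; lra.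
Qed.

(* The Schur complement step: a fresh coordinate carries [l1], and the vector
   of [l1] is the new unit vector. *)
Lemma realizable_peel q l1 l2 l3 :
  realizable (qpeel q l1) (0, 0) l2 l3 -> realizable q l1 l2 l3.
Proof.
case=> n [u [v [w1 [w2 [w3 [[q1 q2 q3] [[_ [? ? ?] [? ? ?]] [_ _ ?]]]]]]]].
exists (n + 1)%N, (row_mx u (const_mx l1.1)), (row_mx v (const_mx l1.2)),
  (row_mx 0 (const_mx 1)), (row_mx w2 (const_mx 0)), (row_mx w3 (const_mx 0)).
move: q1 q2 q3; rewrite /qpeel /= => q1 q2 q3.
by rewrite /covers !dot_row_mx !dot_const1 !dot0v; do !split; lra.
Qed.

Definition activated (s : bool) l := if s then l else (0, 0).

Lemma lin_activated s l x y : lin (activated s l) x y = if s then lin l x y else 0.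
Proof. by case: s => //; rewrite /lin /= !mul0r addr0. Qed.

(* [k (p2 x - p1 y)^2] is what remains of [q] after completing the squares of
   the forms that are active at the zero [(p1, p2)]. *)
Definition tight_at (p1 p2 k : R) (s2 s3 : bool) q l1 l2 l3 :=
  [/\ [/\ 0 <= p1, 0 <= p2, 0 < p1 + p2 & 0 <= k],
    0 <= lin l1 p1 p2,
    if s2 then 0 <= lin l2 p1 p2 else lin l2 p1 p2 <= 0,
    if s3 then 0 <= lin l3 p1 p2 else lin l3 p1 p2 <= 0 &
    forall x y, quad q x y = lin l1 x y ^+ 2 + lin (activated s2 l2) x y ^+ 2 +
      lin (activated s3 l3) x y ^+ 2 + k * (p2 * x - p1 * y) ^+ 2].

Lemma zero_rightward : rightward ((0, 0) : R * R). Proof. by split. Qed.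
Lemma zero_leftward : leftward ((0, 0) : R * R). Proof. by split. Qed.

(** * Vectors for forms with a point of contact *)

Section Tight.
Variables (p1 p2 k : R) (s2 s3 : bool) (q : R * R * R) (l1 l2 l3 : R * R).
Hypotheses (feas : feasible q l1 l2 l3) (tight : tight_at p1 p2 k s2 s3 q l1 l2 l3).

Let r := Num.sqrt k.
(** Coordinate 0 carries the residual square, and coordinates 1 to 3 carry the three forms, with 0
    in place of an inactive one. *)
Let u := row4 (r * p2) l1.1 (activated s2 l2).1 (activated s3 l3).1.
Let v := row4 (- (r * p1)) l1.2 (activated s2 l2).2 (activated s3 l3).2.

Lemma tight_quad : [/\ dot u u <= q.1.1, dot u v <= q.1.2 & dot v v <= q.2].
Proof.
case: tight => -[_ _ _ k0] _ _ _ id.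
have rr : r ^+ 2 = k by rewrite sqr_sqrtr.
have := id 1 0; have := id 0 1; have := id 1 1.
rewrite /quad /lin -rr /u /v !dot_row4 => *; split; lra.
Qed.

(** The vector of [l1] is a unit coordinate vector, so being obtuse to it is a sign condition on
    coordinate 1. *)
Lemma realizable_from_tight w2 w3 :
  covers u v l2 w2 -> covers u v l3 w3 ->
  w2 0 1 <= 0 -> w3 0 1 <= 0 -> dot w2 w3 <= 0 -> realizable q l1 l2 l3.
Proof.
have e1 w : dot (row4 0 1 0 0) w = w 0 1.
  by rewrite /dot !big_ord_recl big_ord0 !mxE /= !mul0r mul1r !addr0 add0r;
    congr (w 0 _); apply/val_inj.
move=> c2 c3 w21 w31 w23; exists 4%N, u, v, (row4 0 1 0 0), w2, w3.
split; first exact: tight_quad.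
split; split=> //; rewrite ?e1 //.
by split; rewrite ?e1 // !mxE.
Qed.

Lemma covers_active2 : s2 -> covers u v l2 (row4 0 0 1 0).
Proof. by move=> h; rewrite /covers /u /v h !dot_row4; split; rewrite /=; lra. Qed.

Lemma covers_active3 : s3 -> covers u v l3 (row4 0 0 0 1).
Proof. by move=> h; rewrite /covers /u /v h !dot_row4; split; rewrite /=; lra. Qed.

Lemma tight_pos x y : 0 <= x -> 0 <= y ->
  pospart_sq (lin l1 x y) + pospart_sq (lin l2 x y) + pospart_sq (lin l3 x y) <=
  lin l1 x y ^+ 2 + lin (activated s2 l2) x y ^+ 2 +
  lin (activated s3 l3) x y ^+ 2 + k * (p2 * x - p1 * y) ^+ 2.
Proof. by move=> x0 y0; case: tight => _ _ _ _ <-; exact: feas. Qed.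

Let pospart_activated s l x y :
  pospart_sq (lin (activated s l) x y) <= pospart_sq (lin l x y).
Proof.
by rewrite lin_activated; case: s => //; rewrite pospart_sq_neg // pospart_sq_ge0.
Qed.

Let pospart_lin0 x y : pospart_sq (lin (0, 0) x y) = 0 :> R.
Proof. by rewrite /lin !mul0r addr0 pospart_sq_neg. Qed.

(** [l1] plays the part of [h] in [inactive_support] and so gets no weight: the vector found is
    orthogonal to that of [l1]. *)
Lemma support2 : rightward l1 -> rightward l2 -> leftward l3 -> ~~ s2 ->
  exists T0 T3, [/\ 0 <= T0, 0 <= T3, T0 ^+ 2 + T3 ^+ 2 <= 1 &
    covers u v l2 (row4 T0 0 0 (- (if s3 then T3 else 0)))].
Proof.
move=> R1 R2 L3 /negbTE ns2; case: (tight) => hp hp1 hp2 hp3 _.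
rewrite ns2 in hp2.
have [|x y x0 y0|T0 [T1 [T2 [T0_ge0 T1_ge0 T2_ge0 TT [T_1 T_2]]]]] :=
  @inactive_support _ k p1 p2 l2 (activated s3 l3) (0, 0) l1 R2 R1 _ zero_leftward hp hp2 hp1.
- by case: (s3).
- have := tight_pos x0 y0; have := pospart_activated s3 l3 x y.
  by rewrite ns2 pospart_lin0 lin_activated [lin (0, 0) x y]/lin !mul0r addr0 expr0n /=; lra.
exists T0, T1; split=> //; first by have := sqr_ge0 T2; lra.
move: T_1 T_2; rewrite /covers /u /v ns2 !dot_row4 /= -/r.
have := sqr_ge0 T2; have := sqr_ge0 T1.
by case: (s3) => /= *; split; lra.
Qed.

(** The mirror image of [support2]: after [flip] the two rightward forms act as [g1] and [g2], and
    the zero form acts as [h]. The flip reverses the residual form, whence the sign of [- T0]. *)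
Lemma support3 : rightward l1 -> rightward l2 -> leftward l3 -> ~~ s3 ->
  exists T0 T1 T2, [/\ 0 <= T0, 0 <= T1, 0 <= T2 &
    covers u v l3 (row4 (- T0) (- T1) (- (if s2 then T2 else 0)) 0)].
Proof.
move=> [R11 R12] [R21 R22] [L31 L32] /negbTE ns3.
case: (tight) => -[p1_ge0 p2_ge0 p_gt0 k0] hp1 hp2 hp3 _.
rewrite ns3 in hp3.
have [||||||x y x0 y0|T0 [T1 [T2 [T0_ge0 T1_ge0 T2_ge0 TT [T_1 T_2]]]]] :=
  @inactive_support _ k p2 p1 (flip l3) (flip l1) (flip (activated s2 l2)) (0, 0) _ zero_rightward.
- by split.
- by split.
- by case: (s2); split.
- by rewrite addrC; split.
- by rewrite lin_flip.
- by rewrite /lin !mul0r addr0.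
- have := tight_pos y0 x0; have := pospart_activated s2 l2 y x.
  rewrite ns3 pospart_lin0 !lin_flip [lin (0, 0) _ _]/lin [lin (activated false _) _ _]/lin /=.
  by rewrite !mul0r addr0 expr0n /= -(opprB (p1 * x)) sqrrN; lra.
exists T0, T1, T2; split=> //.
move: T_1 T_2; rewrite /covers /u /v ns3 !dot_row4 /= -/r.
have := sqr_ge0 T2; have := sqr_ge0 T1.
by case: (s2) => /= *; split; lra.
Qed.

Lemma realizable_tight_RRL :
  rightward l1 -> rightward l2 -> leftward l3 -> realizable q l1 l2 l3.
Proof.
move=> R1 R2 L3.
have [h2|n2] := boolP s2; have [h3|n3] := boolP s3.
- apply: (realizable_from_tight (covers_active2 h2) (covers_active3 h3));
    by rewrite ?dot_row4 ?mxE //=; lra.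
- have [T0 [T1 [T2 [? ? ? c3]]]] := support3 R1 R2 L3 n3.
  rewrite h2 in c3.
  by apply: (realizable_from_tight (covers_active2 h2) c3);
    rewrite ?dot_row4 ?mxE //=; lra.
- have [T0 [T3 [? ? _ c2]]] := support2 R1 R2 L3 n2.
  rewrite h3 in c2.
  by apply: (realizable_from_tight c2 (covers_active3 h3));
    rewrite ?dot_row4 ?mxE //=; lra.
- have [T0 [T3 [? ? _ c2]]] := support2 R1 R2 L3 n2.
  have [T0' [T1 [T2 [? ? ? c3]]]] := support3 R1 R2 L3 n3.
  rewrite (negbTE n3) (negbTE n2) in c2 c3.
  (* The two inactive vectors meet in coordinate 0 only, with opposite signs. *)
  apply: (realizable_from_tight c2 c3); rewrite ?dot_row4 ?mxE //=; first by lra.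
  by have : 0 <= T0 * T0' by [rewrite mulr_ge0]; lra.
Qed.

(** An inactive rightward form is nonpositive at the contact point, where the residual form
    vanishes, so it is dominated by [l.1 / m] times the residual form. Feasibility at [(1, 0)],
    where all three forms are nonnegative, bounds these factors jointly. *)
Lemma realizable_tight_RRR :
  rightward l1 -> rightward l2 -> rightward l3 -> realizable q l1 l2 l3.
Proof.
move=> [R11 R12] [R21 R22] [R31 R32].
case: (tight) => -[p1_ge0 p2_ge0 p_gt0 k0] hp1 hp2 hp3 _.
have rr : r ^+ 2 = k by rewrite sqr_sqrtr.
have r0 : 0 <= r := sqrtr_ge0 k.
have [m Em] : exists m, m = r * p2 by exists (r * p2).
have m0 : 0 <= m by rewrite Em mulr_ge0.
have bound : (if s2 then 0 else l2.1 ^+ 2) + (if s3 then 0 else l3.1 ^+ 2) <= m ^+ 2.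
  have := tight_pos ler01 (lexx 0).
  rewrite !lin_activated /lin !mulr0 !addr0 subr0 !mulr1 !pospart_sq_pos //.
  by rewrite Em exprMn rr; case: (s2); case: (s3); lra.
have T1 l : l.1 ^+ 2 <= m ^+ 2 -> 0 <= l.1 -> l.1 <= l.1 / m * m.
  move=> lm l0; have [mz|mn0] := eqVneq m 0; last by rewrite divfK.
  by rewrite mz mulr0; move: lm; rewrite mz; nra.
have T2 l : l.2 <= 0 -> lin l p1 p2 <= 0 -> l.2 <= l.1 / m * - (r * p1).
  (* For [m = 0] the quotient is 0 by convention and the claim reads [l.2 <= 0]. *)
  rewrite /lin => l2_le0 lp; have [->|mn0] := eqVneq m 0.
    by rewrite invr0 mulr0 mul0r.
  have p2_gt0 : 0 < p2.
    by rewrite lt0r p2_ge0 andbT; apply: contra_neq mn0 => p20; rewrite Em p20 mulr0.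
  have rn0 : r != 0 by apply: contra_neq mn0 => r_0; rewrite Em r_0 mul0r.
  have -> : l.1 / m * - (r * p1) = - (l.1 * p1) / p2.
    by rewrite Em; field; rewrite rn0 gt_eqF.
  by rewrite ler_pdivlMr //; lra.
have bnd2 : ~~ s2 -> l2.1 ^+ 2 <= m ^+ 2.
  by move: bound; case: (s2) => //= b _; have := sqr_ge0 l3.1; move: b; case: (s3); lra.
have bnd3 : ~~ s3 -> l3.1 ^+ 2 <= m ^+ 2.
  by move: bound; case: (s3) => //= b _; have := sqr_ge0 l2.1; move: b; case: (s2); lra.
have unit (a : R) : a <= m ^+ 2 -> a / m ^+ 2 <= 1.
  have [-> _|mn0 am] := eqVneq m 0; first by rewrite expr0n invr0 mulr0 ler01.
  by rewrite ler_pdivrMr ?mul1r // exprn_gt0 // lt0r mn0.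
have [h2|n2] := boolP s2; have [h3|n3] := boolP s3.
- apply: (realizable_from_tight (covers_active2 h2) (covers_active3 h3));
    by rewrite ?dot_row4 ?mxE //=; lra.
- apply: (@realizable_from_tight _ (row4 (l3.1 / m) 0 0 0) (covers_active2 h2));
    rewrite ?dot_row4 ?mxE //=; try lra.
  rewrite (negbTE n3) in hp3.
  have := T1 _ (bnd3 n3) R31; have := T2 _ R32 hp3; have := unit _ (bnd3 n3).
  by rewrite -expr_div_n /covers /u /v !dot_row4 -Em => *; split; lra.
- apply: (@realizable_from_tight (row4 (l2.1 / m) 0 0 0) _ _ (covers_active3 h3));
    rewrite ?dot_row4 ?mxE //=; try lra.
  rewrite (negbTE n2) in hp2.
  have := T1 _ (bnd2 n2) R21; have := T2 _ R22 hp2; have := unit _ (bnd2 n2).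
  by rewrite -expr_div_n /covers /u /v !dot_row4 -Em => *; split; lra.
(* The two inactive vectors are made orthogonal with the coordinate that [l2]
   leaves unused. *)
- apply: (@realizable_from_tight (row4 (l2.1 / m) 0 (l3.1 / m) 0)
    (row4 (l3.1 / m) 0 (- (l2.1 / m)) 0)); rewrite ?dot_row4 ?mxE //=; try lra.
  + rewrite (negbTE n2) in hp2.
    have := T1 _ (bnd2 n2) R21; have := T2 _ R22 hp2; have := unit _ bound.
    rewrite (negbTE n2) (negbTE n3) mulrDl -!expr_div_n.
    by rewrite /covers /u /v !dot_row4 -Em (negbTE n2) => *; split=> /=; lra.
  + rewrite (negbTE n3) in hp3.
    have := T1 _ (bnd3 n3) R31; have := T2 _ R32 hp3; have := unit _ bound.
    rewrite (negbTE n2) (negbTE n3) mulrDl -!expr_div_n.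
    by rewrite /covers /u /v !dot_row4 -Em (negbTE n2) => *; split=> /=; lra.
Qed.

End Tight.

(** * Elimination of the three forms *)

Lemma realizable_tangency q l1 l2 l3 : rightward l1 -> feasible q l1 l2 l3 ->
  (forall q', feasible q' (0, 0) l2 l3 -> realizable q' (0, 0) l2 l3) ->
  (forall l1' p1 p2 k s2 s3, rightward l1' -> feasible q l1' l2 l3 ->
    tight_at p1 p2 k s2 s3 q l1' l2 l3 -> realizable q l1' l2 l3) ->
  realizable q l1 l2 l3.
Proof.
move=> [l11 l12] feas peeled tangent.
(* The weights -1 move the squared positive parts of [l2] and [l3] to the side of [q]. *)
pose e (i : bool) : R := -1; pose l (i : bool) := if i then l2 else l3.
have pwE x y : pwquad q e l x y =
    quad q x y - pospart_sq (lin l2 x y) - pospart_sq (lin l3 x y).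
  by rewrite /pwquad big_bool /e /l /= !mulN1r addrA.
have domE beta : dominated q e l l1.1 beta <-> feasible q (l1.1, - beta) l2 l3.
  by split=> h x y x0 y0; have := h x y x0 y0; rewrite pwE; lra.
have beta0 : 0 <= - l1.2 by rewrite oppr_ge0.
have dom : dominated q e l l1.1 (- l1.2).
  by apply/domE; rewrite opprK -surjective_pairing.
have [/domE|[b [p1 [p2 [k [s [b0 bb /domE feas']]]]]]] := tangency l11 beta0 dom.
  (* With second coefficient 0 the form is nonnegative on the quadrant and can be peeled off. In
     both branches the new form is coefficientwise at least [l1], so [realizable_le] returns to
     [l1]. *)
  rewrite oppr0 => feas0; apply: (@realizable_le _ _ (l1.1, 0)) => //.
  by apply: realizable_peel; apply: peeled; exact: feasible_peel.
case=> -[p1_ge0 p2_ge0 p_gt0 k0 Lp] [sgn id].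
apply: (@realizable_le _ _ (l1.1, - b)) => //=; first by lra.
apply: (tangent _ p1 p2 k (s true) (s false)) => //.
  by split=> //; rewrite oppr_le0.
split=> //.
move=> x y; have := id x y; rewrite big_bool /e /l /= !lin_activated.
by case: (s true); case: (s false) => /=; rewrite ?expr0n /=; lra.
Qed.

(** The copositive 2 by 2 case: the value of [q] at [(b, a)] gives [- (a * b) <= q.1.2], so the
    numbers [a] and [- b] serve as vectors. If [a] or [b] is 0, the bound comes from
    [affine_ge0_slope]. *)
Lemma realizable_000 q : feasible q (0, 0) (0, 0) (0, 0) ->
  realizable q (0, 0) (0, 0) (0, 0).
Proof.
move=> feas.
have feasE x y : 0 <= x -> 0 <= y -> 0 <= quad q x y.
  by move=> x0 y0; apply: le_trans (feas x y x0 y0); rewrite !addr_ge0 ?pospart_sq_ge0.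
have q1 : 0 <= q.1.1.
  by have := feasE 1 0 ler01 (lexx 0); rewrite /quad; lra.
have q2 : 0 <= q.2.
  by have := feasE 0 1 (lexx 0) ler01; rewrite /quad; lra.
pose a := Num.sqrt q.1.1; pose b := Num.sqrt q.2.
have aa : a ^+ 2 = q.1.1 by rewrite sqr_sqrtr.
have bb : b ^+ 2 = q.2 by rewrite sqr_sqrtr.
have a0 : 0 <= a := sqrtr_ge0 _.
have b0 : 0 <= b := sqrtr_ge0 _.
have q12 : - (a * b) <= q.1.2.
  have [az|an0] := eqVneq a 0.
    rewrite az mul0r oppr0; apply: (@affine_ge0_slope _ q.2) => x x0.
    by have := feasE x 1 x0 ler01; rewrite /quad -aa az; lra.
  have [bz|bn0] := eqVneq b 0.
    rewrite bz mulr0 oppr0; apply: (@affine_ge0_slope _ q.1.1) => x x0.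
    by have := feasE 1 x ler01 x0; rewrite /quad -bb bz; lra.
  have ab0 : 0 < a * b by rewrite mulr_gt0 // lt0r ?an0 ?bn0.
  rewrite -subr_ge0 opprK -(pmulr_rge0 _ ab0).
  by have := feasE b a b0 a0; rewrite /quad -aa -bb; lra.
exists 1%N, (const_mx a), (const_mx (- b)), 0, 0, 0.
rewrite /covers !dot_const1 ?dot0v /=; do !split=> //; lra.
Qed.

(** Tangency is applied to each form in turn. A peeled form becomes [(0, 0)], which is both
    rightward and leftward, so every contact met is covered by [realizable_tight_RRL]. *)
Lemma realizable_RRL q l1 l2 l3 : rightward l1 -> rightward l2 -> leftward l3 ->
  feasible q l1 l2 l3 -> realizable q l1 l2 l3.
Proof.
move=> R1 R2 L3 feas1; apply: (realizable_tangency R1 feas1); last first.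
  by move=> l1' p1 p2 k s2 s3 R1' ? /realizable_tight_RRL; exact.
move=> q1 /feasible_swap12 feas2; apply: realizable_swap12.
apply: (realizable_tangency R2 feas2); last first.
  by move=> l2' p1 p2 k s2 s3 R2' ? /realizable_tight_RRL; apply=> //; exact: zero_rightward.
(* Only [l3] is left, and the flip makes it rightward. *)
move=> q2 feas3; apply: realizable_flip.
move: feas3 => /feasible_flip/feasible_swap23/feasible_swap12 feas3.
apply: realizable_swap23; apply: realizable_swap12.
have RL3 : rightward (flip l3) by case: L3.
apply: (realizable_tangency RL3 feas3); last first.
  move=> l3' p1 p2 k s2 s3 R3' ? /realizable_tight_RRL.
  by apply.
by move=> q3; exact: realizable_000.
Qed.

(** Once [l1] is peeled off, the zero form in its place counts as leftward. *)
Lemma realizable_RRR q l1 l2 l3 : rightward l1 -> rightward l2 -> rightward l3 ->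
  feasible q l1 l2 l3 -> realizable q l1 l2 l3.
Proof.
move=> R1 R2 R3 feas1; apply: (realizable_tangency R1 feas1); last first.
  by move=> l1' p1 p2 k s2 s3 R1' ? /realizable_tight_RRR; exact.
move=> q1 /feasible_swap12/feasible_swap23 feas2.
apply: realizable_swap12; apply: realizable_swap23.
by apply: realizable_RRL => //; exact: zero_leftward.
Qed.

(** Up to reordering and [flip], the eight sign patterns reduce to the two already treated. *)
Lemma realizable_mixed q l1 l2 l3 :
  rightward l1 \/ leftward l1 -> rightward l2 \/ leftward l2 ->
  rightward l3 \/ leftward l3 -> feasible q l1 l2 l3 -> realizable q l1 l2 l3.
Proof.
have fl l : leftward l -> rightward (flip l) by case.
have fr l : rightward l -> leftward (flip l) by case.
move=> [R1|/fl L1] [R2|/fl L2] [R3|/fl L3] feas.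
- exact: realizable_RRR.
- by apply: realizable_RRL => //; case: L3.
- apply: realizable_swap23; apply: realizable_RRL => //; first by case: L2.
  exact: feasible_swap23.
- apply: realizable_flip; apply: realizable_swap12; apply: realizable_swap23.
  apply: realizable_RRL (fr _ R1) _ => //.
  exact/feasible_swap23/feasible_swap12/feasible_flip.
- apply: realizable_swap12; apply: realizable_swap23.
  apply: realizable_RRL => //; first by case: L1.
  exact/feasible_swap23/feasible_swap12.
- apply: realizable_flip; apply: realizable_swap23.
  apply: realizable_RRL (fr _ R2) _ => //.
  exact/feasible_swap23/feasible_flip.
- apply: realizable_flip; apply: realizable_RRL (fr _ R3) _ => //.
  exact/feasible_flip.
- by apply: realizable_flip; apply: realizable_RRR => //; exact: feasible_flip.
Qed.

Lemma realizable_wlog_mixed q l1 l2 l3 :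
  (forall q' l1', rightward l1' \/ leftward l1' ->
    feasible q' l1' l2 l3 -> realizable q' l1' l2 l3) ->
  feasible q l1 l2 l3 -> realizable q l1 l2 l3.
Proof.
move=> mixed feas.
have [a0|a0] := leP 0 l1.1; have [b0|b0] := leP 0 l1.2.
- apply: realizable_peel; apply: mixed; first by left; exact: zero_rightward.
  exact: feasible_peel.
- by apply: mixed => //; left; split=> //; exact: ltW.
- by apply: mixed => //; right; split=> //; exact: ltW.
- apply: (@realizable_le _ _ (0, 0)); [exact: ltW|exact: ltW|].
  apply: mixed; first by left; exact: zero_rightward.
  move=> x y x0 y0; apply: le_trans (feas x y x0 y0).
  rewrite !lerD2r pospart_sq_neg ?pospart_sq_ge0 //.
  by rewrite /lin /= !mul0r addr0.
Qed.

Lemma feasible_realizable q l1 l2 l3 : feasible q l1 l2 l3 -> realizable q l1 l2 l3.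
Proof.
apply: realizable_wlog_mixed => {}q {}l1 m1.
move=> /feasible_swap12 feas; apply: realizable_swap12; move: feas.
apply: realizable_wlog_mixed => {}q {}l2 m2.
move=> /feasible_swap12/feasible_swap23/feasible_swap12 feas.
apply/realizable_swap12/realizable_swap23/realizable_swap12; move: feas.
apply: realizable_wlog_mixed => {}q {}l3 m3; exact: realizable_mixed.
Qed.

End Realizable.

(** * From matrices with the pattern of the graph to forms, and back *)

Definition o5 k (lt_k5 : (k < 5)%N) : 'I_5 := Ordinal lt_k5.
Local Notation o0 := (@o5 0 isT).
Local Notation o1 := (@o5 1 isT).
Local Notation o2 := (@o5 2 isT).
Local Notation o3 := (@o5 3 isT).
Local Notation o4 := (@o5 4 isT).

Section Matrices.
Variable R : realType.

Lemma qformE n (A : 'M[R]_n) (x : 'cV[R]_n) :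
  qform A x = \sum_i \sum_j x i 0 * A i j * x j 0.
Proof.
rewrite /qform mxE exchange_big /=; apply: eq_bigr => j _.
by rewrite mxE mulr_suml; apply: eq_bigr => i _; rewrite mxE.
Qed.

Lemma psd_gram m n (V : 'M[R]_(m, n)) : psd (V^T *m V).
Proof.
split=> [|x]; first by rewrite /symmetric_mx trmx_mul trmxK.
rewrite /qform mulmxA -mulmxA -trmx_mul mxE sumr_ge0 // => i _.
by rewrite mxE -expr2 sqr_ge0.
Qed.

Lemma SPN_gram m n (A : 'M[R]_n) (V : 'M[R]_(m, n)) : symmetric_mx A ->
  (forall i j, (V^T *m V) i j <= A i j) -> SPN A.
Proof.
move=> symA VA; exists (V^T *m V), (A - V^T *m V); split.
- exact: psd_gram.
- by rewrite /symmetric_mx linearB /= symA trmx_mul trmxK.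
- by move=> i j; rewrite mxE [X in _ + X]mxE subr_ge0.
- by rewrite addrC subrK.
Qed.

Lemma ord5P (P : 'I_5 -> Prop) : P o0 -> P o1 -> P o2 -> P o3 -> P o4 -> forall i, P i.
Proof.
move=> P0 P1 P2 P3 P4 [[|[|[|[|[|//]]]]] lt_i5].
all: by rewrite (bool_irrelevance lt_i5 isT).
Qed.

Lemma sum5 (F : 'I_5 -> R) : \sum_i F i = F o0 + F o1 + F o2 + F o3 + F o4.
Proof.
rewrite !big_ord_recl big_ord0 addr0 !addrA.
by congr (F _ + F _ + F _ + F _ + F _); apply: val_inj.
Qed.

Lemma mul_pospart (a : R) : a * Num.max 0 a = Num.max 0 a ^+ 2.
Proof.
by have [_|_] := leP 0 a; rewrite -?expr2 // mulr0 expr0n.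
Qed.

Section Pattern.
Variables (a : 'I_5 -> 'I_5 -> R).
Hypotheses (a_sym : forall i j, a i j = a j i)
  (a23 : a o2 o3 = 0) (a24 : a o2 o4 = 0) (a34 : a o3 o4 = 0)
  (a_cop : forall x : 'I_5 -> R, (forall i, 0 <= x i) ->
    0 <= \sum_i \sum_j x i * a i j * x j).

Let form x y r s t :=
  quad (a o0 o0, a o0 o1, a o1 o1) x y +
  (2 * lin (a o0 o2, a o1 o2) x y * r + a o2 o2 * r ^+ 2) +
  (2 * lin (a o0 o3, a o1 o3) x y * s + a o3 o3 * s ^+ 2) +
  (2 * lin (a o0 o4, a o1 o4) x y * t + a o4 o4 * t ^+ 2).

Let form_ge0 x y r s t : 0 <= x -> 0 <= y -> 0 <= r -> 0 <= s -> 0 <= t ->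
  0 <= form x y r s t.
Proof.
move=> x0 y0 r0 s0 t0.
have := @a_cop (fun i => nth 0 [:: x; y; r; s; t] i).
rewrite !sum5 /= (a_sym o1 o0) (a_sym o2 o0) (a_sym o2 o1) (a_sym o3 o0) (a_sym o3 o1).
rewrite (a_sym o3 o2) (a_sym o4 o0) (a_sym o4 o1) (a_sym o4 o2) (a_sym o4 o3) a23 a24 a34.
rewrite /form /quad /lin /= => H; have : forall i : 'I_5, 0 <= [:: x; y; r; s; t]`_i.
  by apply: ord5P.
by move/H; lra.
Qed.

(* With [x / 0 = 0] this is the zero form when the diagonal entry vanishes; the
   entries of that row are then nonnegative. *)
Let scaled i := (- a o0 i / Num.sqrt (a i i), - a o1 i / Num.sqrt (a i i)).

Let diag_ge0 i : 0 <= a i i.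
Proof.
have := form_ge0 ler01 (lexx 0) (lexx 0) (lexx 0) (lexx 0).
have := form_ge0 (lexx 0) ler01 (lexx 0) (lexx 0) (lexx 0).
have := form_ge0 (lexx 0) (lexx 0) ler01 (lexx 0) (lexx 0).
have := form_ge0 (lexx 0) (lexx 0) (lexx 0) ler01 (lexx 0).
have := form_ge0 (lexx 0) (lexx 0) (lexx 0) (lexx 0) ler01.
by rewrite /form /quad /lin /=; move: i; apply: ord5P; lra.
Qed.

Let form_single (i : 'I_5) (x y r : R) : (2 <= i)%N -> 0 <= x -> 0 <= y -> 0 <= r ->
  0 <= quad (a o0 o0, a o0 o1, a o1 o1) x y +
    (2 * lin (a o0 i, a o1 i) x y * r + a i i * r ^+ 2).
Proof.
move=> + x0 y0 r0.
have := form_ge0 x0 y0 r0 (lexx 0) (lexx 0).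
have := form_ge0 x0 y0 (lexx 0) r0 (lexx 0).
have := form_ge0 x0 y0 (lexx 0) (lexx 0) r0.
by rewrite /form; move: i; apply: ord5P => //=; lra.
Qed.

(** Turns a bound from [covers] back into a bound on an entry. If [a i i = 0], the form on one base
    vertex and [i] is affine in the coordinate of [i], so copositivity makes the entry
    nonnegative. *)
Let edge_le (i : 'I_5) b : (b = a o0 i \/ b = a o1 i) -> (2 <= i)%N ->
  forall w : R, - b / Num.sqrt (a i i) <= w -> - Num.sqrt (a i i) * w <= b.
Proof.
move=> bE i2 w; have [sq0|sqn0] := eqVneq (Num.sqrt (a i i)) 0; last first.
  have sq_gt0 : 0 < Num.sqrt (a i i) by rewrite lt0r sqn0 sqrtr_ge0.
  by rewrite ler_pdivrMr //; lra.
move=> _; rewrite sq0 oppr0 mul0r.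
have aii : a i i = 0 by apply/eqP; rewrite eq_le diag_ge0 -sqrtr_eq0 sq0 eqxx.
have H x y r := @form_single i x y r i2.
case: bE => ->.
  apply: (@affine_ge0_slope _ (a o0 o0)) => r r0.
  by have := H 1 0 r ler01 (lexx 0) r0; rewrite aii /quad /lin /=; lra.
apply: (@affine_ge0_slope _ (a o1 o1)) => r r0.
by have := H 0 1 r (lexx 0) ler01 r0; rewrite aii /quad /lin /=; lra.
Qed.

Let scaled_feasible :
  feasible (a o0 o0, a o0 o1, a o1 o1) (scaled o2) (scaled o3) (scaled o4).
Proof.
move=> x y x0 y0.
(* The minimiser over the coordinate of vertex [i]; it is 0 by convention when [a i i = 0]. *)
pose r i := Num.max 0 (lin (scaled i) x y) / Num.sqrt (a i i).
have r0 i : 0 <= r i by rewrite divr_ge0 ?sqrtr_ge0 // le_max lexx.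
have rE i : 2 * lin (a o0 i, a o1 i) x y * r i + a i i * r i ^+ 2 =
    - pospart_sq (lin (scaled i) x y).
  rewrite /r /scaled; have [sq0|sqn0] := eqVneq (Num.sqrt (a i i)) 0.
    rewrite sq0 invr0 !mulr0 expr0n mulr0 addr0.
    by rewrite /lin /= !mul0r addr0 pospart_sq_neg ?oppr0.
  set L := lin (- a o0 i / _, _) x y; set m := Num.max 0 _.
  have LE : lin (a o0 i, a o1 i) x y = - Num.sqrt (a i i) * L.
    by rewrite /L /lin /=; field.
  have := mul_pospart L; rewrite -/m /pospart_sq -/m LE => mE.
  have aE : a i i = Num.sqrt (a i i) ^+ 2 by rewrite sqr_sqrtr ?diag_ge0.
  rewrite [X in _ + X * _]aE.
  have -> : 2 * (- Num.sqrt (a i i) * L) * (m / Num.sqrt (a i i)) = - 2 * (L * m) by field.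
  have -> : Num.sqrt (a i i) ^+ 2 * (m / Num.sqrt (a i i)) ^+ 2 = m ^+ 2 by field.
  by rewrite -mE; ring.
have := form_ge0 x0 y0 (r0 o2) (r0 o3) (r0 o4).
by rewrite /form !rE; lra.
Qed.

Lemma gram_below : exists m (vec : 'I_5 -> 'rV[R]_m), forall i j, dot (vec i) (vec j) <= a i j.
Proof.
have [m [u [v [w1 [w2 [w3 [hq [[c1 c2 c3] [d12 d13 d23]]]]]]]]] :=
  feasible_realizable scaled_feasible.
case: hq; rewrite /= => uu uv vv.
pose sq i := Num.sqrt (a i i).
have sq0 i : 0 <= sq i := sqrtr_ge0 _.
(* The scaling restores the diagonal bounds; the sign change reverses the bounds of [covers] and
   leaves the products among the last three vectors nonpositive. *)
pose vec (i : 'I_5) := nth 0 [:: u; v; - sq o2 *: w1; - sq o3 *: w2; - sq o4 *: w3] i.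
have diag i w : dot w w <= 1 -> dot (- sq i *: w) (- sq i *: w) <= a i i.
  move=> w1_le; rewrite dotZl dotZr mulrA mulrNN -expr2 sqr_sqrtr ?diag_ge0 //.
  by rewrite ler_piMr ?diag_ge0.
have cross i j w w' : dot w w' <= 0 -> dot (- sq i *: w) (- sq j *: w') <= 0.
  by move=> ww; rewrite dotZl dotZr mulrA mulrNN mulr_ge0_le0 // mulr_ge0.
have edges (i : 'I_5) w : (2 <= i)%N -> covers u v (scaled i) w ->
    dot u (- sq i *: w) <= a o0 i /\ dot v (- sq i *: w) <= a o1 i.
  move=> i2 [wu wv _]; rewrite !dotZr !(dotC _ w).
  by split; [apply: edge_le wu => //; left|apply: edge_le wv => //; right].
have upper (i j : 'I_5) : (i <= j)%N -> dot (vec i) (vec j) <= a i j.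
  have [e1 e1'] := edges o2 w1 isT c1; have [e2 e2'] := edges o3 w2 isT c2.
  have [e3 e3'] := edges o4 w3 isT c3.
  case: c1 c2 c3 => _ _ n1 [_ _ n2] [_ _ n3].
  move: i j; apply: ord5P; apply: ord5P => //= _; rewrite /vec /=; try exact: diag.
  + by rewrite a23; exact: cross.
  + by rewrite a24; exact: cross.
  + by rewrite a34; exact: cross.
exists m, vec => i j; have [/upper//|/ltnW/upper] := leqP i j.
by rewrite dotC a_sym.
Qed.

End Pattern.

End Matrices.

Theorem theorem1 (R : realType) : SPN_graph R T5.
Proof.
move=> n A symA [_ copA] [f [g fK gK] f_adj].
(* Reading [A] along the isomorphism gives entries indexed by the vertices of [T5], with no need to
   identify [n] with 5. *)
pose a i j := A (g i) (g j).
have A_sym i j : A i j = A j i by rewrite -{1}symA mxE.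
have nonadj (i j : 'I_5) : i != j -> T5_adj i j = false -> a i j = 0.
  move=> ij; rewrite -{1}(gK i) -{1}(gK j) => nij.
  have := f_adj (g i) (g j); rewrite /= {}nij /mx_adj (can_eq gK) ij /=.
  by move/esym/negbFE/eqP.
have a_cop (x : 'I_5 -> R) : (forall i, 0 <= x i) -> 0 <= \sum_i \sum_j x i * a i j * x j.
  move=> x0; have := copA (\col_k x (f k)); rewrite qformE.
  have g_bij : {on predT, bijective g} by exists f => ? _.
  rewrite (reindex g g_bij) => H; apply: le_trans (H _) _ => [i j|].
    by rewrite mxE.
  rewrite le_eqVlt; apply/predU1P; left; apply: eq_bigr => i _.
  by rewrite (reindex g g_bij); apply: eq_bigr => j _; rewrite !mxE !gK.
have [m [vec vec_le]] := @gram_below _ a (fun i j => A_sym _ _)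
  (nonadj o2 o3 isT erefl)
  (nonadj o2 o4 isT erefl) (nonadj o3 o4 isT erefl) a_cop.
apply: (@SPN_gram _ m n A (\matrix_(r, j) vec (f j) 0 r)) => // i j.
have -> : A i j = a (f i) (f j) by rewrite /a !fK.
apply: le_trans (vec_le _ _); rewrite mxE le_eqVlt; apply/predU1P; left.
by apply: eq_bigr => r _; rewrite !mxE.
Qed.
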